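(* Let $f:M\to M$ be a diffeomorphism of a closed manifold $M$, let $\Lambda\subset M$ be a compact $f$-invariant set, let $k\ge2$, and let $T_\Lambda M=E_1\oplus\cdots\oplus E_k$ be a $Df$-invariant splitting with $\dim E_i(x)=n_i\ge1$ for all $x\in\Lambda$, with corresponding oblique projectors $P_1,\dots,P_k$. For $N\in\mathbb Z^+$, $x\in\Lambda$ and $i=1,\dots,k-1$ set $$\rho^+_{N,i}(x)=\frac1N\log\|Df^N(x)P_i(x)\|,\qquad \rho^-_{N,i}(x)=-\frac1N\log\|P_{i+1}(x)Df^{-N}(f^N(x))\|.$$ Then the splitting is $(n_1,\dots,n_k)$-dominated if and only if there exist a constant $\alpha>0$ and $N_0\in\mathbb Z^+$ such that for all $N\ge N_0$ and all $i=1,\dots,k-1$: the function $\rho^+_{N,i}$ is an upper function of $E_i$ with respect to $f$ over $\Lambda$, the function $\rho^-_{N,i}$ is a lower function of $E_{i+1}$ with respect to $f$ over $\Lambda$, and $$\rho^+_{N,i}(x)-\rho^-_{N,i}(x)\le-\frac{\alpha}{2}\qquad\text{for all }x\in\Lambda.$$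
   Context: The tangent bundle of $M$ carries a continuous inner product, with induced norm $\|\cdot\|$ (also used for operator norms). For $n\in\mathbb Z$, $Df^n(x):T_xM\to T_{f^n(x)}M$ is the derivative of $f^n$ at $x$, so $Df^{-n}(f^n(x)):T_{f^n(x)}M\to T_xM$ is its inverse. $T_\Lambda M$ is the restriction of $TM$ to $\Lambda$. A splitting $T_xM=E_1(x)\oplus\cdots\oplus E_k(x)$, $x\in\Lambda$, is $Df$-invariant if $Df(x)E_i(x)=E_i(f(x))$ for all $x\in\Lambda$ and all $i$; $P_i(x)$ is the oblique projection of $T_xM$ onto $E_i(x)$ along $\bigoplus_{j\ne i}E_j(x)$ (not assumed continuous in $x$). Dominated splitting: the splitting (with $\dim E_i=n_i$) is $(n_1,\dots,n_k)$-dominated if there are constants $C>1$, $\alpha>0$ such that for every $i<j$, every $x\in\Lambda$, every $u,v\in T_xM$ and all $m,n\in\mathbb Z$ with $m\ge0$, $$\frac{\|Df^{n+m}(x)P_i(x)u\|\,\|Df^n(x)P_j(x)v\|}{\|Df^n(x)P_i(x)u\|\,\|Df^{n+m}(x)P_j(x)v\|}\le Ce^{-m\alpha},$$ whenever the denominator does not vanish. Upper and lower functions: a function $g:\Lambda\to\mathbb R$ is an upper function of $E_i$ with respect to $f$ over $\Lambda$ if there is a constant $K_i>1$ such that for all $x\in\Lambda$ and all $n,m\in\mathbb Z$ with $m\ge1$, $$\|Df^{n+m}(x)P_i(x)Df^{-n}(f^n(x))\|\le K_i\exp\Big(\sum_{j=n}^{n+m-1}g(f^j(x))\Big);$$ it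 is a lower function of $E_i$ with respect to $f$ over $\Lambda$ if there is a constant $K_i>1$ such that for all $x\in\Lambda$ and all $n,m\in\mathbb Z$ with $m\ge1$, $$\|Df^{n}(x)P_i(x)Df^{-(n+m)}(f^{n+m}(x))\|\le K_i\exp\Big(-\sum_{j=n}^{n+m-1}g(f^j(x))\Big).$$ *)

(* Defs.v *)
From HB Require Import structures.
From mathcomp Require Import all_boot all_order all_algebra.
From mathcomp Require Import all_classical all_reals all_analysis.

Set Implicit Arguments.
Unset Strict Implicit.
Unset Printing Implicit Defensive.

Import Order.TTheory GRing.Theory Num.Theory.
Import numFieldNormedType.Exports.

Local Open Scope classical_set_scope.
Local Open Scope ring_scope.

(* U is meant to be open, so that the values of ['J h] outside U, where h need
   not be differentiable, do not matter. *)
Definition C1_on (R : realType) (d e : nat) (U : set 'rV[R]_d)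
    (h : 'rV[R]_d -> 'rV[R]_e) : Prop :=
  forall p, U p ->
    differentiable h p /\ {for p, continuous (fun q => 'J h q)}.

(* A homeomorphism from an open subset of M onto an open subset of R^d. The two
   maps are total functions, whose values outside these sets are irrelevant. *)
Record chart (R : realType) (d : nat) (M : topologicalType) := Chart {
  chart_dom : set M;
  chart_fun :> M -> 'rV[R]_d;
  chart_inv : 'rV[R]_d -> M;
  open_chart_dom : open chart_dom;
  open_chart_img : open (chart_fun @` chart_dom);
  chart_funK : forall x, chart_dom x -> chart_inv (chart_fun x) = x;
  chart_fun_continuous : {within chart_dom, continuous chart_fun};
  chart_inv_continuous :
    {within chart_fun @` chart_dom, continuous chart_inv}
}.

(* No smoothness beyond C^1 is required of the atlas, which need not be
   maximal; second countability follows from compactness. *)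
Record closedManifold (R : realType) (d : nat) := ClosedManifold {
  carrier :> topologicalType;
  manifold_hausdorff : hausdorff_space carrier;
  manifold_compact : compact [set: carrier];
  atlas : set (chart R d carrier);
  atlas_cover : forall x, exists phi, atlas phi /\ chart_dom phi x;
  atlas_C1 : forall phi psi, atlas phi -> atlas psi ->
    C1_on (phi @` (chart_dom phi `&` chart_dom psi)) (psi \o chart_inv phi)
}.

Section Manifold.
Variables (R : realType) (d : nat) (M : closedManifold R d).

(* A chart around each point is fixed by choice. A tangent vector at x is
   represented by its row vector of coordinates in [chart_at x], so that every
   T_xM is 'rV[R]_d; functions below that depend on the tangent spaces they act
   between take the base points as arguments. *)
Definition chart_at (x : M) : chart R d M := projT1 (cid (atlas_cover x)).

Definition C1_map (f : M -> M) : Prop :=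
  continuous f /\
  forall phi psi, atlas phi -> atlas psi ->
    C1_on (phi @` (chart_dom phi `&` f @^-1` chart_dom psi))
      (psi \o f \o chart_inv phi).

Record diffeo := Diffeo {
  diffeo_fun :> M -> M;
  diffeo_inv : M -> M;
  diffeoK : cancel diffeo_fun diffeo_inv;
  diffeo_invK : cancel diffeo_inv diffeo_fun;
  diffeo_C1 : C1_map diffeo_fun;
  diffeo_inv_C1 : C1_map diffeo_inv
}.

Definition iterz (f : diffeo) (n : int) : M -> M :=
  match n with
  | Posz m => iter m f
  | Negz m => iter m.+1 (diffeo_inv f)
  end.

(* The derivative T_xM -> T_(f x)M of f at x. *)
Definition tangent_map (f : M -> M) (x : M) : 'End('rV[R]_d) :=
  linfun ('d (chart_at (f x) \o f \o chart_inv (chart_at x)) (chart_at x x)).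

(* [gram x] is the Gram matrix of the inner product of T_xM. In the chart phi
   the inner product at y has Gram matrix J *m gram y *m J^T, where
   u |-> u *m J changes coordinates from phi to [chart_at y]. *)
Record continuous_metric := ContinuousMetric {
  gram : M -> 'M[R]_d;
  gram_sym : forall x, (gram x)^T = gram x;
  gram_posdef : forall x (u : 'rV[R]_d),
    u != 0 -> 0 < (u *m gram x *m u^T) ord0 ord0;
  gram_continuous : forall phi, atlas phi ->
    {within chart_dom phi, continuous (fun y =>
      let J := 'J (chart_at y \o chart_inv phi) (phi y) in
      J *m gram y *m J^T)}
}.

Variable g : continuous_metric.

Definition tnorm (x : M) (u : 'rV[R]_d) : R :=
  Num.sqrt ((u *m gram g x *m u^T) ord0 ord0).

(* The operator norm of A : T_xM -> T_yM. *)
Definition opnorm (x y : M) (A : 'End('rV[R]_d)) : R :=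
  sup [set tnorm y (A u) | u in [set u | tnorm x u <= 1]].

Variables (f : diffeo) (L : set M) (k : nat).
Variable E : 'I_k -> M -> {vspace 'rV[R]_d}.

(* Df^n(x) : T_xM -> T_(f^n x)M. *)
Definition Diter (n : int) (x : M) : 'End('rV[R]_d) := tangent_map (iterz f n) x.

Definition invariant_splitting (dims : 'I_k -> nat) : Prop :=
  forall x, L x ->
    [/\ directv (\sum_i E i x)%VS,
        (\sum_i E i x)%VS = fullv,
        forall i, \dim (E i x) = dims i
      & forall i, (Diter 1 x @: E i x)%VS = E i (f x)].

(* The oblique projection of T_xM onto E_i(x) along the sum of the others. *)
Definition oblique_proj (i : 'I_k) (x : M) : 'End('rV[R]_d) :=
  daddv_pi (E i x) (\sum_(j < k | j != i) E j x)%VS.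

Definition dominated : Prop :=
  exists C alpha : R, [/\ 1 < C, 0 < alpha &
    forall (i j : 'I_k) (x : M) (u v : 'rV[R]_d) (n : int) (m : nat),
      (i < j)%N -> L x ->
      let den := tnorm (iterz f n x) (Diter n x (oblique_proj i x u)) *
                 tnorm (iterz f (n + m%:Z) x) (Diter (n + m%:Z) x (oblique_proj j x v)) in
      den != 0 ->
      tnorm (iterz f (n + m%:Z) x) (Diter (n + m%:Z) x (oblique_proj i x u)) *
      tnorm (iterz f n x) (Diter n x (oblique_proj j x v)) / den
        <= C * expR (- (m%:R * alpha))].

(* The sums over l are sums over j = n + l from n to n + m - 1. The values of h
   outside L play no role, L being invariant. *)
Definition upper_function (i : 'I_k) (h : M -> R) : Prop :=
  exists K : R, 1 < K /\
    forall (x : M) (n : int) (m : nat), L x -> (1 <= m)%N ->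
      opnorm (iterz f n x) (iterz f (n + m%:Z) x)
        (Diter (n + m%:Z) x \o oblique_proj i x \o Diter (- n) (iterz f n x))%VF
      <= K * expR (\sum_(l < m) h (iterz f (n + l%:Z) x)).

Definition lower_function (i : 'I_k) (h : M -> R) : Prop :=
  exists K : R, 1 < K /\
    forall (x : M) (n : int) (m : nat), L x -> (1 <= m)%N ->
      opnorm (iterz f (n + m%:Z) x) (iterz f n x)
        (Diter n x \o oblique_proj i x \o Diter (- (n + m%:Z)) (iterz f (n + m%:Z) x))%VF
      <= K * expR (- \sum_(l < m) h (iterz f (n + l%:Z) x)).

(* rho^+_{N,i} is [rho_plus N i] and rho^-_{N,i} is [rho_minus N j] with
   j = i + 1: the argument is the index of the projection. *)
Definition rho_plus (N : nat) (i : 'I_k) (x : M) : R :=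
  N%:R^-1 * ln (opnorm x (iterz f N%:Z x) (Diter N%:Z x \o oblique_proj i x)%VF).

Definition rho_minus (N : nat) (j : 'I_k) (x : M) : R :=
  - (N%:R^-1 *
     ln (opnorm (iterz f N%:Z x) x
           (oblique_proj j x \o Diter (- N%:Z) (iterz f N%:Z x))%VF)).

End Manifold.

(* Main.v *)
(* If the splitting is dominated, applying a large power of Df to nearly
   parallel vectors of E_1 + ... + E_l and E_(l+1) shows that the angles between
   the bundles are bounded below, hence the projections P_i are bounded. The
   function a(x, m) = log |Df^m(x) P_i(x)| is subadditive over f and changes by a
   bounded amount when m changes by at most N, so N a(x, m) is at most the sum of
   a(f^l x, N) over l < m, up to a constant: this says that rho^+ is an upper
   function; rho^- is treated in the same way. Domination also bounds
   |Df^N P_i| |P_(i+1) Df^-N| by a multiple of exp(- N alpha).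
   Conversely, an upper function of E_i and a lower function of E_(i+1) with a
   gap bound the ratio in the definition of domination for adjacent bundles, and
   these bounds are multiplied along a chain of nonzero vectors of the
   intermediate bundles. *)
Require Import Defs.
From mathcomp Require Import all_boot all_order all_algebra.
From mathcomp Require Import all_classical all_reals all_analysis.
From mathcomp Require Import ring lra.
Import Order.TTheory GRing.Theory Num.Theory.
Import numFieldNormedType.Exports.
Set Implicit Arguments.
Unset Strict Implicit.
Unset Printing Implicit Defensive.
Local Open Scope classical_set_scope.
Local Open Scope ring_scope.

(** * Matrices and positive definite forms *)

Section MatrixNorm.
Variables (R : realType).

Lemma le_mx_norm m n (A : 'M[R]_(m, n)) i j : `|A i j| <= `|A|.
Proof.
rewrite [leRHS]/Num.norm /= mx_normrE.
by apply/bigmax_geP; right; exists (i, j).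
Qed.

Lemma mx_norm_le m n (A : 'M[R]_(m, n)) (c : R) :
  0 <= c -> (forall i j, `|A i j| <= c) -> `|A| <= c.
Proof.
move=> c0 H; rewrite [leLHS]/Num.norm /= mx_normrE.
by apply/bigmax_leP; split => // -[i j] _; apply: H.
Qed.

Lemma mulmx_norm_le m n p (A : 'M[R]_(m, n)) (B : 'M[R]_(n, p)) :
  `|A *m B| <= n%:R * `|A| * `|B|.
Proof.
apply: mx_norm_le => [|i j]; first by rewrite !mulr_ge0.
rewrite mxE (le_trans (ler_norm_sum _ _ _))//.
have -> : n%:R * `|A| * `|B| = \sum_(l < n) (`|A| * `|B|).
  by rewrite sumr_const card_ord -[RHS]mulr_natl mulrA.
by apply: ler_sum => l _; rewrite normrM ler_pM// le_mx_norm.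
Qed.

Lemma trmx_norm m n (A : 'M[R]_(m, n)) : `|A^T| = `|A|.
Proof.
apply/eqP; rewrite eq_le; apply/andP; split.
  by apply: mx_norm_le => // i j; rewrite mxE le_mx_norm.
apply: mx_norm_le => // i j.
by rewrite -[A i j](mxE trmx_key (fun j i => A i j)) le_mx_norm.
Qed.

End MatrixNorm.

(** * Positive definite bilinear forms compared with the max-norm *)

Definition bform (R : realType) d (G : 'M[R]_d) (u v : 'rV[R]_d) : R :=
  (u *m G *m v^T) ord0 ord0.

Definition posdef (R : realType) d (G : 'M[R]_d) :=
  forall u : 'rV[R]_d, u != 0 -> 0 < bform G u u.

Section BilinearForm.
Variables (R : realType) (d : nat) (G : 'M[R]_d).
Implicit Types u v w : 'rV[R]_d.

Lemma bformDl u v w : bform G (u + v) w = bform G u w + bform G v w.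
Proof. by rewrite /bform !mulmxDl mxE. Qed.

Lemma bformZl a u v : bform G (a *: u) v = a * bform G u v.
Proof. by rewrite /bform -!scalemxAl mxE. Qed.

Lemma bformDr u v w : bform G u (v + w) = bform G u v + bform G u w.
Proof. by rewrite /bform linearD mulmxDr mxE. Qed.

Lemma bformZr a u v : bform G u (a *: v) = a * bform G u v.
Proof. by rewrite /bform linearZ -scalemxAr mxE. Qed.

Lemma bformB H u v : bform (G - H) u v = bform G u v - bform H u v.
Proof. by rewrite /bform mulmxBr mulmxBl !mxE. Qed.

Lemma bform_norm_le u v : `|bform G u v| <= d%:R ^+ 2 * `|G| * `|u| * `|v|.
Proof.
rewrite /bform (le_trans (le_mx_norm _ _ _))// (le_trans (mulmx_norm_le _ _))//.
rewrite trmx_norm ler_wpM2r// expr2 -!mulrA ler_wpM2l//.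
by rewrite (le_trans (mulmx_norm_le _ _))// -!mulrA ler_wpM2l// mulrC.
Qed.

Hypothesis Gsym : G^T = G.

Lemma bformC u v : bform G u v = bform G v u.
Proof.
rewrite /bform -[RHS](mxE trmx_key (fun i j => (v *m G *m u^T) j i)).
by rewrite -/(trmx _) !trmx_mul trmxK Gsym mulmxA.
Qed.

Hypothesis Gpos : posdef G.

Lemma posdef_ge0 u : 0 <= bform G u u.
Proof.
have [->|/Gpos/ltW//] := eqVneq u 0.
by rewrite -(scale0r (0 : 'rV[R]_d)) bformZl mul0r.
Qed.

(** The form is nonnegative at G(v,v) u - G(u,v) v, where its value is G(v,v) times the difference
    of the two sides. *)
Lemma bform_cauchy_schwarz u v : bform G u v ^+ 2 <= bform G u u * bform G v v.
Proof.
have [->|v0] := eqVneq v 0.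
  by rewrite -(scale0r (0 : 'rV[R]_d)) !bformZr !mul0r expr0n mulr0.
have := posdef_ge0 (bform G v v *: u - bform G u v *: v).
rewrite -scaleNr bformDl !bformDr !bformZl !bformZr (bformC v u).
set a := bform G u u; set b := bform G u v; have := Gpos v0.
set c := bform G v v => c0 H.
rewrite -subr_ge0 -(pmulr_rge0 _ c0).
by apply: le_trans H _; rewrite le_eqVlt; apply/orP; left; apply/eqP; ring.
Qed.

Lemma bform_minkowski u v :
  Num.sqrt (bform G (u + v) (u + v)) <=
  Num.sqrt (bform G u u) + Num.sqrt (bform G v v).
Proof.
rewrite -(@ler_pXn2r _ 2)// ?nnegrE ?addr_ge0 ?sqrtr_ge0//.
rewrite sqr_sqrtr ?posdef_ge0// sqrrD !sqr_sqrtr ?posdef_ge0//.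
rewrite !bformDl !bformDr (bformC v u).
have : bform G u v <= Num.sqrt (bform G u u) * Num.sqrt (bform G v v).
  rewrite -sqrtrM ?posdef_ge0// (le_trans (ler_norm _))// -sqrtr_sqr.
  by rewrite ler_wsqrtr// bform_cauchy_schwarz.
lra.
Qed.

(* [c] is the minimum of the form over the unit sphere of the max-norm. *)
Lemma posdef_lower_bound :
  exists2 c : R, 0 < c & forall u, c * `|u| ^+ 2 <= bform G u u.
Proof.
pose S := [set u : 'rV[R]_d | `|u| = 1].
have [S0|/set0P/negP/negPn/eqP S0] := pselect (S !=set0); last first.
  (* The unit sphere is empty only in dimension 0, where the sole vector is 0 and any constant will
     do. *)
  exists 1 => // u; have [->|u0] := eqVneq u 0.
    by rewrite normr0 expr0n mulr0 posdef_ge0.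
  have : S (`|u|^-1 *: u).
    by rewrite /S/= normrZ normfV normr_id mulVf// normr_eq0.
  by rewrite S0.
have cS : compact S.
  apply: bounded_closed_compact.
    exists 1; split; first exact: num_real.
    by move=> y y1 u /= ->; exact: ltW.
  have -> : S = (@Num.norm R _) @^-1` [set 1] by [].
  apply: closed_comp => [u _|]; first exact: norm_continuous.
  exact: closed_eq.
have cG : continuous (fun u => bform G u u).
  have -> : (fun u => bform G u u) =
      (fun u => \sum_j (\sum_i u ord0 i * G i j) * u ord0 j).
    by apply/funext => u; rewrite /bform mxE; apply: eq_bigr => j _; rewrite !mxE.
  apply: (@continuous_big R^o _ +%R 0 xpredT (@add_continuous R^o)) => j _ u.
  apply: (@cvgM _ _ (nbhs u)); last exact: coord_continuous.
  suff H : continuous (fun w : 'rV[R]_d => \sum_i w ord0 i * G i j) by exact: H.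
  apply: (@continuous_big R^o _ +%R 0 xpredT (@add_continuous R^o)) => i _ v.
  by apply: (@cvgM _ _ (nbhs v)); [exact: coord_continuous|exact: cvg_cst].
have [v + vmin] := EVT_min_rV S0 cS (continuous_subspaceT cG).
rewrite inE => Sv; exists (bform G v v).
  apply: Gpos; apply/eqP => v0.
  by move: Sv; rewrite /S/= v0 normr0 => /eqP; rewrite eq_sym oner_eq0.
move=> u; have [->|u0] := eqVneq u 0.
  by rewrite normr0 expr0n mulr0 posdef_ge0.
have nu : `|u| != 0 by rewrite normr_eq0.
have Su : `|u|^-1 *: u \in S.
  by rewrite inE /S/= normrZ normfV normr_id mulVf.
have := vmin _ Su; rewrite bformZl bformZr.
by rewrite !ler_pdivlMl ?normr_gt0// mulrA -expr2 mulrC.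
Qed.

End BilinearForm.

(** * Charts, tangent maps and norms *)

Section NearDiff.
Variables (R : realType) (V W : normedModType R).

(** The first-order expansion at [x] depends only on the germ there. This is needed because
    identities between charts hold only near the point under study. *)
Lemma near_eq_diff (f h : V -> W) x :
  differentiable f x -> {near nbhs x, f =1 h} ->
  differentiable h x /\ 'd h x = 'd f x :> (V -> W).
Proof.
move=> df fh.
have fhx : f x = h x by exact: (nbhs_singleton fh).
have loc : h \o shift x = cst (h x) + 'd f x +o_ 0 id.
  apply/eqaddoP => e e0.
  have /eqaddoP/(_ e e0) := diff_locally df.
  have : \forall y \near 0, f (y + x) = h (y + x).
    have := near_shift 0 x (fun y => f y = h y).
    rewrite -[(\forall y \near x, f y = h y)]/({near nbhs x, f =1 h}) => e1.
    by move: fh; rewrite e1; apply: filterS => y /=; rewrite subr0.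
  apply: filterS2 => y fhy.
  by rewrite /= ![in X in X -> _]fctE ![in X in _ -> X]fctE /= fhy /cst fhx.
have dh : 'd h x = 'd f x :> (V -> W).
  by apply: diff_unique => //; exact: diff_continuous.
split=> //; apply/diff_locallyP; rewrite dh; split => //.
exact: diff_continuous.
Qed.

End NearDiff.

(** * Charts, coordinate changes and the chain rule *)

Section Charts.
Variables (R : realType) (d : nat).

Lemma chart_inv_cvg (M : topologicalType) (phi : chart R d M) x :
  chart_dom phi x -> chart_inv phi p @[p --> phi x] --> x.
Proof.
move=> xphi; have := chart_inv_continuous (c := phi).
rewrite continuous_open_subspace; last exact: open_chart_img.
move=> /(_ (phi x)); rewrite inE => /(_ (ex_intro2 _ _ x xphi erefl)).
by rewrite /continuous_at chart_funK.
Qed.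

Lemma chart_fun_cvg (M : topologicalType) (phi : chart R d M) x :
  chart_dom phi x -> phi y @[y --> x] --> phi x.
Proof.
move=> xphi; have := chart_fun_continuous (c := phi).
rewrite continuous_open_subspace; last exact: open_chart_dom.
by move=> /(_ x); rewrite inE; apply.
Qed.

Variable M : closedManifold R d.
Implicit Types (phi psi chi : chart R d M) (h : M -> M).

Lemma atlas_chart_at (x : M) : atlas (chart_at x).
Proof. by rewrite /chart_at; case: cid => phi []. Qed.

Lemma chart_at_dom (x : M) : chart_dom (chart_at x) x.
Proof. by rewrite /chart_at; case: cid => phi []. Qed.

(** Inserting [chart_inv psi \o psi] between [h1] and [h2] changes nothing near [phi x], since [h1]
    is continuous and the domain of [psi] is open; the ordinary chain rule then applies. *)
Lemma differentiable_chart_comp phi psi chi h1 h2 x :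
  chart_dom phi x -> chart_dom psi (h1 x) -> {for x, continuous h1} ->
  differentiable (psi \o h1 \o chart_inv phi) (phi x) ->
  differentiable (chi \o h2 \o chart_inv psi) (psi (h1 x)) ->
  differentiable (chi \o (h2 \o h1) \o chart_inv phi) (phi x) /\
  'd (chi \o (h2 \o h1) \o chart_inv phi) (phi x) =
  'd (chi \o h2 \o chart_inv psi) (psi (h1 x)) \o
  'd (psi \o h1 \o chart_inv phi) (phi x) :> (_ -> _).
Proof.
move=> xphi hpsi ch d1 d2.
have e : (psi \o h1 \o chart_inv phi) (phi x) = psi (h1 x).
  by rewrite /= chart_funK.
rewrite -e in d2 *.
rewrite -(diff_comp d1 d2).
apply: near_eq_diff; first exact: differentiable_comp.
have : \forall p \near phi x, chart_dom psi (h1 (chart_inv phi p)).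
  have : \forall y \near x, chart_dom psi (h1 y).
    by apply: ch; apply: open_nbhs_nbhs; split=> //; exact: open_chart_dom.
  exact: chart_inv_cvg.
by apply: filterS => p /= pd; rewrite chart_funK.
Qed.

(* Weaker than [C1_map], but enough for the chain rule and inherited by all
   iterates without tracking the continuity of their Jacobians. *)
Definition mdiff h := continuous h /\
  forall phi psi x, atlas phi -> atlas psi ->
    chart_dom phi x -> chart_dom psi (h x) ->
    differentiable (psi \o h \o chart_inv phi) (phi x).

Lemma mdiff_id : mdiff id.
Proof.
split=> [x|phi psi x aphi apsi xphi xpsi]; first exact: cvg_id.
by case: (atlas_C1 aphi apsi (p := phi x)) => //; exists x.
Qed.

Lemma C1_map_mdiff h : C1_map h -> mdiff h.
Proof.
case=> ch C1; split=> // phi psi x aphi apsi xphi xpsi.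
by case: (C1 _ _ aphi apsi (phi x)) => //; exists x.
Qed.

Lemma mdiff_comp h1 h2 : mdiff h1 -> mdiff h2 -> mdiff (h2 \o h1).
Proof.
move=> [c1 d1] [c2 d2]; split=> [x|phi psi x aphi apsi xphi xpsi].
  by apply: continuous_comp; [exact: c1|exact: c2].
have [] // := @differentiable_chart_comp phi (chart_at (h1 x)) psi h1 h2 x.
- exact: chart_at_dom.
- exact: c1.
- by apply: d1 => //; [exact: atlas_chart_at|exact: chart_at_dom].
- by apply: d2 => //; [exact: atlas_chart_at|exact: chart_at_dom].
Qed.

Lemma tangent_mapE h x u : tangent_map h x u =
  'd (chart_at (h x) \o h \o chart_inv (chart_at x)) (chart_at x x) u.
Proof. by rewrite lfunE. Qed.

Lemma tangent_map_comp h1 h2 x u : mdiff h1 -> mdiff h2 ->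
  tangent_map (h2 \o h1) x u = tangent_map h2 (h1 x) (tangent_map h1 x u).
Proof.
move=> [c1 d1] [c2 d2].
have [||||| _ E] := @differentiable_chart_comp
    (chart_at x) (chart_at (h1 x)) (chart_at (h2 (h1 x))) h1 h2 x.
- exact: chart_at_dom.
- exact: chart_at_dom.
- exact: c1.
- by apply: d1; do ?[exact: atlas_chart_at|exact: chart_at_dom].
- by apply: d2; do ?[exact: atlas_chart_at|exact: chart_at_dom].
transitivity ('d (chart_at (h2 (h1 x)) \o h2 \o chart_inv (chart_at (h1 x)))
    (chart_at (h1 x) (h1 x)) (tangent_map h1 x u)); last first.
  by symmetry; exact: tangent_mapE.
apply: etrans (tangent_mapE (h2 \o h1) x u) _.
apply: etrans (congr1 (@^~ u) E) _.
exact: (congr1 ('d (chart_at (h2 (h1 x)) \o h2 \o chart_inv (chart_at (h1 x)))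
  (chart_at (h1 x) (h1 x)) : _ -> _) (esym (tangent_mapE h1 x u))).
Qed.

Lemma chart_diff_id phi x u : chart_dom phi x ->
  'd (phi \o id \o chart_inv phi) (phi x) u = u.
Proof.
move=> xphi.
have near_id : {near nbhs (phi x), id =1 phi \o id \o chart_inv phi}.
  have : nbhs (phi x) (phi @` chart_dom phi).
    by apply: open_nbhs_nbhs; split; [exact: open_chart_img|exists x].
  by apply: filterS => _ [y yphi <-] /=; rewrite chart_funK.
have [|_ ->] := near_eq_diff _ near_id; first by [].
by rewrite diff_val.
Qed.

Lemma chart_change phi psi chi x u : atlas phi -> atlas psi -> atlas chi ->
    chart_dom phi x -> chart_dom psi x -> chart_dom chi x ->
  'd (chi \o id \o chart_inv psi) (psi x)
    ('d (psi \o id \o chart_inv phi) (phi x) u) =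
  'd (chi \o id \o chart_inv phi) (phi x) u.
Proof.
move=> aphi apsi achi xphi xpsi xchi; have [_ did] := mdiff_id.
have [] // := @differentiable_chart_comp phi psi chi id id x xphi xpsi.
- exact: did.
- exact: did.
- by move=> _ E; exact: (esym (congr1 (@^~ u) E)).
Qed.

Lemma mul_jacobian (f : 'rV[R]_d -> 'rV[R]_d) p u : u *m 'J f p = 'd f p u.
Proof. by rewrite /jacobian mul_rV_lin1. Qed.

(** * Norms on tangent spaces and operator norms *)

Variable g : continuous_metric M.

Lemma posdef_gram x : posdef (gram g x).
Proof. by move=> u; exact: gram_posdef. Qed.

Lemma tnormE x u : tnorm g x u = Num.sqrt (bform (gram g x) u u).
Proof. by []. Qed.

Lemma tnorm_ge0 x u : 0 <= tnorm g x u.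
Proof. exact: sqrtr_ge0. Qed.

Lemma tnormZ x a u : tnorm g x (a *: u) = `|a| * tnorm g x u.
Proof.
rewrite !tnormE bformZl bformZr mulrA -expr2 sqrtrM ?sqr_ge0//.
by rewrite sqrtr_sqr.
Qed.

Lemma tnorm0 x : tnorm g x 0 = 0.
Proof. by rewrite -(scale0r (0 : 'rV[R]_d)) tnormZ normr0 mul0r. Qed.

Lemma tnormN x u : tnorm g x (- u) = tnorm g x u.
Proof. by rewrite -scaleN1r tnormZ normrN1 mul1r. Qed.

Lemma tnormD x u v : tnorm g x (u + v) <= tnorm g x u + tnorm g x v.
Proof. exact: (bform_minkowski (gram_sym g x) (posdef_gram x)). Qed.

Lemma tnorm_gt0 x u : (0 < tnorm g x u) = (u != 0).
Proof.
have [->|u0] := eqVneq u 0; first by rewrite tnorm0 ltxx.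
by rewrite sqrtr_gt0; exact: gram_posdef.
Qed.

(** Both norms are compared with the max-norm of coordinates. This makes the set in [opnorm]
    bounded, so that its [sup] is a genuine least upper bound. *)
Lemma tnorm_End_bounded x y (A : 'End('rV[R]_d)) :
  exists2 c, 0 <= c & forall u, tnorm g y (A u) <= c * tnorm g x u.
Proof.
have [c c0 cP] := posdef_lower_bound (posdef_gram x).
pose B := d%:R ^+ 2 * `|gram g y| * (d%:R * `|lin1_mx A|) ^+ 2.
exists (Num.sqrt (B / c)) => [|u]; first exact: sqrtr_ge0.
have B0 : 0 <= B by rewrite !mulr_ge0 ?exprn_ge0 ?mulr_ge0.
rewrite !tnormE -sqrtrM ?divr_ge0 ?(ltW c0)// ler_wsqrtr//.
rewrite (le_trans (ler_norm _))// (le_trans (bform_norm_le _ _ _))//.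
apply: le_trans (_ : B / c * (c * `|u| ^+ 2) <= _); last first.
  by rewrite ler_wpM2l// divr_ge0// ltW.
rewrite mulrA divfK ?gt_eqF// /B -[leRHS]mulrA -exprMn -[leLHS]mulrA -expr2.
rewrite ler_wpM2l ?mulr_ge0 ?exprn_ge0// lerXn2r ?nnegrE ?mulr_ge0//.
by rewrite -mul_rV_lin1 (le_trans (mulmx_norm_le _ _))// mulrAC.
Qed.

Lemma le_opnorm x y (A : 'End('rV[R]_d)) u :
  tnorm g y (A u) <= opnorm g x y A * tnorm g x u.
Proof.
have [u0|u0] := eqVneq u 0; first by rewrite u0 linear0 !tnorm0 mulr0.
have nu : 0 < tnorm g x u by rewrite tnorm_gt0.
rewrite -ler_pdivrMr// mulrC -[(_)^-1]ger0_norm ?invr_ge0 ?(ltW nu)//.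
rewrite -tnormZ -linearZ/=; apply: ub_le_sup.
  have [c c0 cP] := tnorm_End_bounded x y A; exists c => _ [v /= v1 <-].
  by rewrite (le_trans (cP v))// ler_piMr.
exists ((tnorm g x u)^-1 *: u) => //=.
by rewrite tnormZ ger0_norm ?invr_ge0 ?(ltW nu)// mulVf// gt_eqF.
Qed.

Lemma opnorm_le x y (A : 'End('rV[R]_d)) c : 0 <= c ->
  (forall u, tnorm g y (A u) <= c * tnorm g x u) -> opnorm g x y A <= c.
Proof.
move=> c0 cP; apply: ge_sup.
  by exists (tnorm g y (A 0)); exists 0 => //=; rewrite tnorm0.
by move=> _ [v /= v1 <-]; rewrite (le_trans (cP v))// ler_piMr.
Qed.

Lemma opnorm_ge0 x y (A : 'End('rV[R]_d)) : 0 <= opnorm g x y A.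
Proof.
apply: ub_le_sup; last by exists 0; rewrite /= ?tnorm0 ?linear0 ?tnorm0.
have [c c0 cP] := tnorm_End_bounded x y A; exists c => _ [v /= v1 <-].
by rewrite (le_trans (cP v))// ler_piMr.
Qed.

(** The metric read in the fixed chart [phi]. It varies continuously with [y], whereas [gram g y]
    refers to [chart_at y], which may jump. *)
Definition chart_gram phi y :=
  let J := 'J (chart_at y \o chart_inv phi) (phi y) in
  J *m gram g y *m J^T.

Lemma bform_chart_gram phi y w :
  bform (chart_gram phi y) w w =
  tnorm g y ('d (chart_at y \o id \o chart_inv phi) (phi y) w) ^+ 2.
Proof.
rewrite tnormE sqr_sqrtr ?posdef_ge0//; last first.
  by move=> u; exact: gram_posdef.
by rewrite -mul_jacobian /bform /chart_gram/= trmx_mul !mulmxA.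
Qed.

Lemma chart_gram_posdef phi y :
  atlas phi -> chart_dom phi y -> posdef (chart_gram phi y).
Proof.
move=> aphi yphi w w0; rewrite bform_chart_gram exprn_gt0// tnorm_gt0.
apply: contra_neq w0 => w0.
have := chart_change w aphi (atlas_chart_at y) aphi yphi (chart_at_dom y) yphi.
set D := 'd _ (chart_at y y) => E.
exact: etrans (esym (chart_diff_id w yphi))
  (etrans (esym E) (etrans (congr1 D w0) (linear0 D))).
Qed.

Lemma chart_gram_cvg phi y : atlas phi -> chart_dom phi y ->
  chart_gram phi z @[z --> y] --> chart_gram phi y.
Proof.
move=> aphi yphi; have := gram_continuous (c := g) aphi.
rewrite continuous_open_subspace; last exact: open_chart_dom.
by move=> /(_ y); rewrite inE; apply.
Qed.

(** Both sides are the derivative of [h] read from [phi] to [chart_at (h y)], factored through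
    [chart_at y] on the left and through [psi] on the right. *)
Lemma tangent_map_chart h psi phi y w : mdiff h ->
    atlas phi -> atlas psi -> chart_dom phi y -> chart_dom psi (h y) ->
  tangent_map h y ('d (chart_at y \o id \o chart_inv phi) (phi y) w) =
  'd (chart_at (h y) \o id \o chart_inv psi) (psi (h y))
    ('d (psi \o h \o chart_inv phi) (phi y) w).
Proof.
move=> [ch dh] aphi apsi yphi ypsi; have [_ did] := mdiff_id.
have ay := atlas_chart_at y; have ahy := atlas_chart_at (h y).
have cy := chart_at_dom y; have chy := chart_at_dom (h y).
rewrite tangent_mapE.
have [|||_ E1] := @differentiable_chart_comp phi (chart_at y)
    (chart_at (h y)) id h y yphi cy.
- exact: (mdiff_id.1 _).
- exact: did.
- exact: dh.
have [|||_ E2] := @differentiable_chart_comp phi psi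
    (chart_at (h y)) h id y yphi ypsi.
- exact: ch.
- exact: dh.
- exact: did.
exact: (congr1 (@^~ w) (etrans (esym E1) E2)).
Qed.

(** In charts fixed around [x] and [h x], the Jacobian of [h] and both Gram matrices are continuous,
    so their values at [x] control them nearby. *)
Lemma tangent_map_locally_bounded h (x : M) : C1_map h ->
  exists2 C, 0 <= C & \forall y \near x, forall u,
    tnorm g (h y) (tangent_map h y u) <= C * tnorm g y u.
Proof.
move=> C1h; have dh := C1_map_mdiff C1h; have [ch _] := dh.
set phi := chart_at x; set psi := chart_at (h x).
have aphi : atlas phi by exact: atlas_chart_at.
have apsi : atlas psi by exact: atlas_chart_at.
have xphi : chart_dom phi x by exact: chart_at_dom.
have xpsi : chart_dom psi (h x) by exact: chart_at_dom.
pose J y := 'J (psi \o h \o chart_inv phi) (phi y).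
have cJ : J y @[y --> x] --> J x.
  have [|_ cJ] := C1h.2 _ _ aphi apsi (phi x); first by exists x.
  exact: cvg_comp (chart_fun_cvg xphi) cJ.
have cG := chart_gram_cvg aphi xphi.
have cH : chart_gram psi (h y) @[y --> x] --> chart_gram psi (h x).
  exact: cvg_comp (ch x) (chart_gram_cvg apsi xpsi).
have [c c0 cP] :=
  posdef_lower_bound (chart_gram_posdef aphi xphi).
pose a := d%:R ^+ 2 * (`|chart_gram psi (h x)| + 1) * (d%:R * (`|J x| + 1)) ^+ 2.
have a0 : 0 <= a by rewrite !mulr_ge0 ?exprn_ge0 ?mulr_ge0 ?addr_ge0.
(* Moving the Gram matrix by at most [e] changes the form by at most half of its lower bound [c];
   the [+ 1] keeps the denominator positive when d = 0. *)
pose e := c / 2 / (d%:R ^+ 2 + 1).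
have d2 : 0 < d%:R ^+ 2 + 1 :> R by rewrite ltr_wpDl ?exprn_ge0.
have e0 : 0 < e by rewrite !divr_gt0.
exists (Num.sqrt (a / (c / 2))); first exact: sqrtr_ge0.
have near_norm (V : normedModType R) (F : M -> V) : F y @[y --> x] --> F x ->
    \forall y \near x, `|F y| <= `|F x| + 1.
  move=> /cvgrPdist_le/(_ 1 ltr01); apply: filterS => y Fy.
  rewrite -lerBlDl (le_trans _ Fy)// distrC.
  exact: (le_trans (ler_norm _) (ler_dist_dist _ _)).
near=> y => u.
have yphi : chart_dom phi y.
  near: y; apply: open_nbhs_nbhs; split=> //; exact: open_chart_dom.
have ypsi : chart_dom psi (h y).
  near: y; apply: ch; apply: open_nbhs_nbhs; split=> //; exact: open_chart_dom.
(* [w] holds the coordinates of [u] in the fixed chart [phi]. *)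
pose w := 'd (phi \o id \o chart_inv (chart_at y)) (chart_at y y) u.
have -> : u = 'd (chart_at y \o id \o chart_inv phi) (phi y) w.
  apply: esym; apply: etrans (chart_diff_id u (chart_at_dom y)).
  by apply: chart_change => //; [exact: atlas_chart_at|exact: atlas_chart_at
    |exact: chart_at_dom|exact: chart_at_dom].
rewrite (tangent_map_chart w dh aphi apsi)//.
rewrite -(@ler_pXn2r _ 2)// ?nnegrE ?mulr_ge0 ?tnorm_ge0 ?sqrtr_ge0//.
rewrite exprMn -!bform_chart_gram sqr_sqrtr; last by rewrite !divr_ge0 ?(ltW c0).
rewrite -mul_jacobian -/(J y).
have lower : c / 2 * `|w| ^+ 2 <= bform (chart_gram phi y) w w.
  have H1 : `|chart_gram phi x - chart_gram phi y| <= e.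
    by near: y; move/cvgrPdist_le: cG; exact.
  have := le_trans (ler_norm _)
    (bform_norm_le (chart_gram phi x - chart_gram phi y) w w).
  rewrite bformB -mulrA -expr2.
  have half (b b' n D : R) : c * n <= b -> b - b' <= D -> D <= c / 2 * n ->
    c / 2 * n <= b' by lra.
  move=> H2; apply: half (cP w) H2 _.
  rewrite ler_wpM2r ?exprn_ge0//.
  apply: le_trans (_ : (d%:R ^+ 2 + 1) * e <= _).
    by rewrite ler_pM ?exprn_ge0// lerDl.
  by rewrite /e mulrC divfK ?gt_eqF.
have upper : bform (chart_gram psi (h y)) (w *m J y) (w *m J y) <= a * `|w| ^+ 2.
  rewrite (le_trans (ler_norm _))// (le_trans (bform_norm_le _ _ _))//.
  rewrite /a -[leRHS]mulrA -exprMn -[leLHS]mulrA -expr2.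
  apply: ler_pM; rewrite ?mulr_ge0 ?exprn_ge0//.
    by rewrite ler_wpM2l ?exprn_ge0//; near: y; exact: near_norm cH.
  rewrite lerXn2r ?nnegrE ?mulr_ge0 ?addr_ge0//.
  rewrite (le_trans (mulmx_norm_le _ _))// mulrAC ler_wpM2r// ler_wpM2l//.
  by near: y; exact: near_norm cJ.
rewrite (le_trans upper)//.
apply: le_trans (_ : a / (c / 2) * (c / 2 * `|w| ^+ 2) <= _).
  by rewrite [leRHS]mulrA divfK// gt_eqF// divr_gt0.
by rewrite ler_wpM2l// divr_ge0// divr_ge0// ltW.
Unshelve. all: by end_near. Qed.

(** Compactness is used as a covering property with the filter at infinity on the constants: a local
    bound stays valid for every larger constant. *)
Lemma tangent_map_bounded h (L : set M) : compact L -> C1_map h ->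
  exists2 C, 0 <= C & forall y, L y -> forall u,
    tnorm g (h y) (tangent_map h y u) <= C * tnorm g y u.
Proof.
move=> cL C1h.
have /compact_near_coveringP/near_covering_withinP := cL.
pose P (C : R) y := forall u, tnorm g (h y) (tangent_map h y u) <= C * tnorm g y u.
move=> /(_ _ (@pinfty_nbhs R) P _) [x Lx|C0 [_ C0P]].
  have [C C0 Cnear] := tangent_map_locally_bounded x C1h.
  exists ([set y | P C y], [set C' | C < C']).
    by split=> //=; exists C; split=> //; exact: num_real.
  move=> [y C'] [/= Py CC'] _ u.
  by rewrite (le_trans (Py u))// ler_wpM2r ?tnorm_ge0// ltW.
exists (Num.max 0 C0 + 1).
  by rewrite addr_ge0// le_max lexx.
move=> y Ly; apply: (C0P (Num.max 0 C0 + 1)) => //.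
by rewrite ltr_pwDr// le_max lexx orbT.
Qed.
End Charts.

(** * Domination for linear cocycles *)

(* The sum of [a 0 (m + s)] over [s < N] grows by [a 0 (m + N) - a 0 m <= a m N]
   when [m] increases by one. *)
Lemma subadditive_birkhoff (R : realType) (a : nat -> nat -> R) (N : nat) (B : R) :
  (forall q, a 0%N (q + N)%N <= a 0%N q + a q N) ->
  (forall s, (s < N)%N -> a 0%N s <= B) ->
  (forall m s, (s < N)%N -> a 0%N m <= a 0%N (m + s)%N + B) ->
  forall m, N%:R * a 0%N m <= \sum_(l < m) a l N + 2 * N%:R * B.
Proof.
move=> subadd a_le a_shift m.
have sumB : N%:R * B = \sum_(s < N) B by rewrite sumr_const card_ord mulr_natl.
have avg : \sum_(s < N) a 0%N (m + s)%N <= \sum_(l < m) a l N + N%:R * B.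
  elim: m => [|m IH].
    by rewrite big_ord0 add0r sumB; apply: ler_sum => s _; exact: a_le (ltn_ord s).
  have -> : \sum_(s < N) a 0%N (m.+1 + s)%N =
      \sum_(s < N) a 0%N (m + s)%N + a 0%N (m + N)%N - a 0%N m.
    have : \sum_(s < N.+1) a 0%N (m + s)%N =
        a 0%N m + \sum_(s < N) a 0%N (m.+1 + s)%N.
      rewrite big_ord_recl addn0; congr (_ + _).
      by apply: eq_bigr => s _; rewrite /bump/= addnA addn1.
    by rewrite big_ord_recr/= => ->; rewrite addrC addKr.
  rewrite big_ord_recr/=; have := subadd m; lra.
(* Replacing each of the [N] copies of [a 0 m] by [a 0 (m + s)] costs [B]; with the cost of the base
   case of [avg] this gives 2 N B. *)
have : N%:R * a 0%N m <= \sum_(s < N) (a 0%N (m + s)%N + B).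
  rewrite mulr_natl -[X in _ *+ X](card_ord N) -sumr_const.
  by apply: ler_sum => s _; exact: a_shift (ltn_ord s).
rewrite big_split/= -sumB; lra.
Qed.

(* [F n], [A n], [P i], [nu] and [opn] stand for f^n, Df^n, the projection P_i,
   the norms of the tangent spaces and the operator norms between them. *)
Section Cocycle.
Variables (R : realType) (V : vectType R) (X : Type) (k : nat) (L : set X).
Variables (F : int -> X -> X) (A : int -> X -> 'End(V)).
Variables (P : 'I_k -> X -> 'End(V)).
Variables (nu : X -> V -> R) (opn : X -> X -> 'End(V) -> R).

Hypothesis FL : forall n x, L x -> L (F n x).
Hypothesis F0 : forall x, F 0 x = x.
Hypothesis FD : forall (n m : int) x, F (n + m) x = F m (F n x).
Hypothesis A0 : forall x u, A 0 x u = u.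
Hypothesis AD : forall (n m : int) x u, A (n + m) x u = A m (F n x) (A n x u).

Hypothesis P_id : forall i x u, L x -> P i x (P i x u) = P i x u.
Hypothesis P_sum : forall x u, L x -> \sum_i P i x u = u.
Hypothesis P_neq0 : forall i x, L x -> exists u, P i x u != 0.
Hypothesis PA : forall i n x u, L x -> A n x (P i x u) = P i (F n x) (A n x u).

Hypothesis nu_ge0 : forall x u, 0 <= nu x u.
Hypothesis nu_gt0 : forall x u, (0 < nu x u) = (u != 0).
Hypothesis nuN : forall x u, nu x (- u) = nu x u.
Hypothesis nuD : forall x u v, nu x (u + v) <= nu x u + nu x v.

Hypothesis opn_ge0 : forall x y (B : 'End(V)), 0 <= opn x y B.
Hypothesis le_opn : forall x y (B : 'End(V)) u, nu y (B u) <= opn x y B * nu x u.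
Hypothesis opn_le : forall x y (B : 'End(V)) c, 0 <= c ->
  (forall u, nu y (B u) <= c * nu x u) -> opn x y B <= c.

Variable kappa : R.
Hypothesis kappa_ge1 : 1 <= kappa.
Hypothesis nu_forward : forall x u, L x -> nu (F 1 x) (A 1 x u) <= kappa * nu x u.
Hypothesis nu_backward : forall x u, L x ->
  nu (F (-1) x) (A (-1) x u) <= kappa * nu x u.

Let kappa_ge0 : 0 <= kappa. Proof. exact: le_trans kappa_ge1. Qed.

Let nu0 x : nu x 0 = 0.
Proof. by apply/eqP; rewrite eq_le nu_ge0 andbT leNgt nu_gt0 eqxx. Qed.

Let nu_eq0 x u : nu x u = 0 -> u = 0.
Proof. by move=> u0; apply/eqP; rewrite -[_ == _]negbK -(nu_gt0 x) u0 ltxx. Qed.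

Lemma FK n x : F (- n) (F n x) = x.
Proof. by rewrite -FD subrr F0. Qed.

Lemma AK n x u : A (- n) (F n x) (A n x u) = u.
Proof. by rewrite -AD subrr A0. Qed.

Lemma AVK n x u : A n x (A (- n) (F n x) u) = u.
Proof. by rewrite -[in A n x](FK n x) -AD addNr A0. Qed.

Lemma AVP j n x u : L x ->
  A (- n) (F n x) (P j (F n x) u) = P j x (A (- n) (F n x) u).
Proof. by move=> Lx; rewrite PA ?FK//; exact: FL. Qed.

Lemma A_neq0 n x u : u != 0 -> A n x u != 0.
Proof. by apply: contra_neq => Au; rewrite -(AK n x u) Au linear0. Qed.

Lemma nu_pow (s : nat) x u : L x -> nu (F s x) (A s x u) <= kappa ^+ s * nu x u.
Proof.
move=> Lx; elim: s => [|s IH]; first by rewrite F0 A0 expr0 mul1r.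
rewrite -addn1 PoszD FD AD (le_trans (nu_forward _ (FL _ Lx)))//.
by rewrite addn1 exprS -mulrA ler_wpM2l.
Qed.

Lemma nu_powV (s : nat) x u : L x ->
  nu (F (- s%:Z) x) (A (- s%:Z) x u) <= kappa ^+ s * nu x u.
Proof.
move=> Lx; elim: s => [|s IH]; first by rewrite oppr0 F0 A0 expr0 mul1r.
rewrite -addn1 PoszD opprD FD AD (le_trans (nu_backward _ (FL _ Lx)))//.
by rewrite addn1 exprS -mulrA ler_wpM2l.
Qed.

Lemma nu_le_pow (s : nat) x u : L x -> nu x u <= kappa ^+ s * nu (F s x) (A s x u).
Proof.
by move=> Lx; have := nu_powV s (A s x u) (FL s Lx); rewrite FK AK.
Qed.

(** * Birkhoff bounds for submultiplicative growth *)

Section Growth.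
Variables (c : X -> nat -> R) (p : R) (N : nat).
Hypothesis N_gt0 : (0 < N)%N.
Hypothesis p_ge1 : 1 <= p.
Hypothesis c_gt0 : forall x m, L x -> 0 < c x m.
Hypothesis c_submul : forall x q, L x -> c x (q + N)%N <= c x q * c (F q x) N.
Hypothesis c_le : forall x s, L x -> c x s <= p * kappa ^+ s.
Hypothesis c_shift : forall x m s, L x -> c x m <= kappa ^+ s * c x (m + s)%N.

(** Logarithms of [c] along the orbit of [x] satisfy [subadditive_birkhoff]. The hypotheses are
    abstract so that forward and backward growth are both covered. *)
Lemma growth_birkhoff : exists2 K : R, 1 < K &
  forall x (m : nat), L x ->
    c x m <= K * expR (\sum_(l < m) N%:R^-1 * ln (c (F l x) N)).
Proof.
pose B := ln (p * kappa ^+ N).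
exists (expR (2 * B) + 1) => [|x m Lx]; first by rewrite ltrDr expR_gt0.
have p0 : 0 < p by exact: lt_le_trans p_ge1.
have kappa_gt0 : 0 < kappa by exact: lt_le_trans kappa_ge1.
have kN s : (s < N)%N -> kappa ^+ s <= kappa ^+ N.
  by move=> sN; rewrite ler_weXn2l// ltnW.
have pk0 : 0 < p * kappa ^+ N by rewrite mulr_gt0// exprn_gt0.
have cF n q : 0 < c (F n x) q by apply: c_gt0; exact: FL.
have H : N%:R * ln (c x m) <= \sum_(l < m) ln (c (F l x) N) + 2 * N%:R * B.
  rewrite -[X in ln (c X m)]F0.
  apply: (@subadditive_birkhoff R (fun l q => ln (c (F (Posz l) x) q)) N B).
  - move=> q; rewrite F0 -lnM ?posrE ?cF ?c_gt0//.
    by rewrite ler_ln ?posrE ?mulr_gt0 ?cF ?c_gt0// c_submul.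
  - move=> s sN; rewrite F0 ler_ln ?posrE ?c_gt0//.
    by rewrite (le_trans (c_le _ _))// ler_wpM2l ?(ltW p0)// kN.
  - move=> q s sN; rewrite F0 addrC -lnM ?posrE ?exprn_gt0 ?c_gt0//.
    rewrite ler_ln ?posrE ?mulr_gt0 ?exprn_gt0 ?c_gt0//.
    rewrite (le_trans (c_shift _ s _))// ler_wpM2r ?(ltW (c_gt0 _ _))//.
    by rewrite (le_trans (kN _ sN))// ler_peMl// exprn_ge0.
have N0 : 0 < N%:R :> R by rewrite ltr0n.
rewrite -[leLHS]lnK ?posrE ?c_gt0//.
apply: le_trans (_ : expR (2 * B) *
  expR (\sum_(l < m) N%:R^-1 * ln (c (F l x) N)) <= _).
  rewrite -expRD ler_expR -mulr_sumr -(ler_pM2l N0) mulrDr mulVKf ?gt_eqF//.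
  by rewrite addrC (le_trans H)// lerD2l mulrCA mulrA.
by rewrite ler_wpM2r ?expR_ge0// lerDl.
Qed.
End Growth.

(** [cdominated], [cupper] and [clower] become convertible to [dominated], [upper_function] and
    [lower_function] once the data are instantiated. *)
Definition cdominated : Prop :=
  exists C alpha : R, [/\ 1 < C, 0 < alpha &
    forall (i j : 'I_k) x (u v : V) (n : int) (m : nat), (i < j)%N -> L x ->
      let den := nu (F n x) (A n x (P i x u)) *
                 nu (F (n + m%:Z) x) (A (n + m%:Z) x (P j x v)) in
      den != 0 ->
      nu (F (n + m%:Z) x) (A (n + m%:Z) x (P i x u)) *
      nu (F n x) (A n x (P j x v)) / den
        <= C * expR (- (m%:R * alpha))].

Definition cupper (i : 'I_k) (h : X -> R) : Prop :=
  exists K : R, 1 < K /\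
    forall x (n : int) (m : nat), L x -> (1 <= m)%N ->
      opn (F n x) (F (n + m%:Z) x)
        (A (n + m%:Z) x \o P i x \o A (- n) (F n x))%VF
      <= K * expR (\sum_(l < m) h (F (n + l%:Z) x)).

Definition clower (i : 'I_k) (h : X -> R) : Prop :=
  exists K : R, 1 < K /\
    forall x (n : int) (m : nat), L x -> (1 <= m)%N ->
      opn (F (n + m%:Z) x) (F n x)
        (A n x \o P i x \o A (- (n + m%:Z)) (F (n + m%:Z) x))%VF
      <= K * expR (- \sum_(l < m) h (F (n + l%:Z) x)).

(** For N >= 1 and x in [L], [fgrowth i x N] is exp(N rho^+) and [bgrowth j x N] is exp(- N rho^-),
    with j = i + 1. *)
Definition fgrowth i x (m : nat) := opn x (F m x) (A m x \o P i x)%VF.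

Definition bgrowth j x (m : nat) :=
  opn (F m x) x (P j x \o A (- m%:Z) (F m x))%VF.

Lemma fgrowth_ge0 i x m : 0 <= fgrowth i x m. Proof. exact: opn_ge0. Qed.

Lemma bgrowth_ge0 j x m : 0 <= bgrowth j x m. Proof. exact: opn_ge0. Qed.

(** * Forward and backward growth under bounded projections *)

Section ProjBounded.
Variable p : R.
Hypothesis p_ge1 : 1 <= p.
Hypothesis P_le : forall i x u, L x -> nu x (P i x u) <= p * nu x u.

Let p_ge0 : 0 <= p. Proof. exact: le_trans p_ge1. Qed.

Lemma fgrowth_gt0 i x m : L x -> 0 < fgrowth i x m.
Proof.
move=> Lx; have [u Pu] := P_neq0 i Lx.
have := le_opn x (F m x) (A m x \o P i x)%VF u.
rewrite /fgrowth lt_def opn_ge0 andbT comp_lfunE => H.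
apply: contraTneq H => ->; rewrite mul0r -ltNge nu_gt0.
exact: A_neq0.
Qed.

Lemma bgrowth_gt0 j x m : L x -> 0 < bgrowth j x m.
Proof.
move=> Lx; have [u Pu] := P_neq0 j Lx.
have := le_opn (F m x) x (P j x \o A (- m%:Z) (F m x))%VF (A m x u).
rewrite /bgrowth lt_def opn_ge0 andbT comp_lfunE AK => H.
by apply: contraTneq H => ->; rewrite mul0r -ltNge nu_gt0.
Qed.

(** As the projection is idempotent and commutes with the cocycle, a second copy of it can be
    inserted at the intermediate point [F q x]. *)
Lemma fgrowth_submul i x q N : L x ->
  fgrowth i x (q + N)%N <= fgrowth i x q * fgrowth i (F q x) N.
Proof.
move=> Lx; apply: opn_le => [|u]; first by rewrite mulr_ge0 ?fgrowth_ge0.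
rewrite comp_lfunE PoszD FD AD -[P i x u]P_id// PA//.
have := le_opn (F q x) (F N (F q x)) (A N (F q x) \o P i (F q x))%VF
  (A q x (P i x u)).
rewrite comp_lfunE => /le_trans; apply.
rewrite -/(fgrowth i (F q x) N) (mulrC (fgrowth i x q)) -mulrA.
rewrite ler_wpM2l ?fgrowth_ge0//.
by have := le_opn x (F q x) (A q x \o P i x)%VF u; rewrite comp_lfunE.
Qed.

Lemma bgrowth_submul j x q N : L x ->
  bgrowth j x (q + N)%N <= bgrowth j x q * bgrowth j (F q x) N.
Proof.
move=> Lx; apply: opn_le => [|w]; first by rewrite mulr_ge0 ?bgrowth_ge0.
rewrite comp_lfunE PoszD opprD FD [in - _ - _]addrC AD FK -[P j x _]P_id// -AVP//.
have := le_opn (F q x) x (P j x \o A (- q%:Z) (F q x))%VF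
  (P j (F q x) (A (- N%:Z) (F N (F q x)) w)).
rewrite comp_lfunE => /le_trans; apply.
rewrite -/(bgrowth j x q) -mulrA ler_wpM2l ?bgrowth_ge0//.
have := le_opn (F N (F q x)) (F q x)
  (P j (F q x) \o A (- N%:Z) (F N (F q x)))%VF w.
by rewrite comp_lfunE.
Qed.

Lemma fgrowth_le i x s : L x -> fgrowth i x s <= p * kappa ^+ s.
Proof.
move=> Lx; apply: opn_le => [|u]; first by rewrite mulr_ge0// exprn_ge0.
rewrite comp_lfunE (le_trans (nu_pow _ _ Lx))// (mulrC p) -mulrA.
by rewrite ler_wpM2l ?exprn_ge0// P_le.
Qed.

Lemma bgrowth_le j x s : L x -> bgrowth j x s <= p * kappa ^+ s.
Proof.
move=> Lx; apply: opn_le => [|w]; first by rewrite mulr_ge0// exprn_ge0.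
rewrite comp_lfunE (le_trans (P_le _ _ Lx))// -mulrA ler_wpM2l//.
by have := nu_powV s w (FL s Lx); rewrite FK.
Qed.

Lemma fgrowth_shift i x m s : L x ->
  fgrowth i x m <= kappa ^+ s * fgrowth i x (m + s)%N.
Proof.
move=> Lx; apply: opn_le => [|u]; first by rewrite mulr_ge0 ?fgrowth_ge0// exprn_ge0.
rewrite comp_lfunE (le_trans (nu_le_pow s _ (FL _ Lx)))// -mulrA.
rewrite ler_wpM2l ?exprn_ge0// -AD -FD -PoszD.
have := le_opn x (F (m + s)%N x) (A (m + s)%N x \o P i x)%VF u.
by rewrite comp_lfunE.
Qed.

Lemma bgrowth_shift j x m s : L x ->
  bgrowth j x m <= kappa ^+ s * bgrowth j x (m + s)%N.
Proof.
move=> Lx; apply: opn_le => [|w]; first by rewrite mulr_ge0 ?bgrowth_ge0// exprn_ge0.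
have := le_opn (F (m + s)%N x) x
  (P j x \o A (- (m + s)%N%:Z) (F (m + s)%N x))%VF (A s (F m x) w).
have e : A (- (m + s)%N%:Z) (F (m + s)%N x) (A s (F m x) w) = A (- m%:Z) (F m x) w.
  by rewrite PoszD FD opprD [- _ - _]addrC AD AK FK.
rewrite !comp_lfunE e => /le_trans; apply.
rewrite -/(bgrowth j x (m + s)) (mulrC (kappa ^+ s)) -mulrA.
by rewrite ler_wpM2l ?bgrowth_ge0// PoszD FD nu_pow//; exact: FL.
Qed.

Lemma fgrowth_upper i N : (0 < N)%N ->
  cupper i (fun x => N%:R^-1 * ln (fgrowth i x N)).
Proof.
move=> N0; have [||||K K1 KP] := @growth_birkhoff (fgrowth i) p N N0 p_ge1.
- by move=> *; exact: fgrowth_gt0.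
- by move=> *; exact: fgrowth_submul.
- by move=> *; exact: fgrowth_le.
- by move=> *; exact: fgrowth_shift.
exists K; split=> // x n m Lx m1.
under eq_bigr do rewrite FD.
apply: le_trans (KP (F n x) m (FL n Lx)).
apply: opn_le => [|u]; first exact: opn_ge0.
(* By equivariance the operator in [cupper] is the forward operator of length [m] at the point
   [F n x]. *)
rewrite !comp_lfunE FD AD PA// AVK.
have := le_opn (F n x) (F m (F n x)) (A m (F n x) \o P i (F n x))%VF u.
by rewrite comp_lfunE.
Qed.

Lemma bgrowth_lower j N : (0 < N)%N ->
  clower j (fun x => - (N%:R^-1 * ln (bgrowth j x N))).
Proof.
move=> N0; have [||||K K1 KP] := @growth_birkhoff (bgrowth j) p N N0 p_ge1.
- by move=> *; exact: bgrowth_gt0.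
- by move=> *; exact: bgrowth_submul.
- by move=> *; exact: bgrowth_le.
- by move=> *; exact: bgrowth_shift.
exists K; split=> // x n m Lx m1.
rewrite sumrN opprK; under eq_bigr do rewrite FD.
apply: le_trans (KP (F n x) m (FL n Lx)).
apply: opn_le => [|w]; first exact: opn_ge0.
rewrite !comp_lfunE opprD FD [in - _ - _]addrC AD FK PA// AVK.
have := le_opn (F m (F n x)) (F n x)
  (P j (F n x) \o A (- m%:Z) (F m (F n x)))%VF w.
by rewrite comp_lfunE.
Qed.

End ProjBounded.

(** Domination started at time 0 and cleared of its denominator, hence without an exceptional
    case. *)
Definition mul_dominated (C alpha : R) : Prop :=
  forall (i j : 'I_k) x u v (m : nat), (i < j)%N -> L x ->
    nu (F m x) (A m x (P i x u)) * nu x (P j x v) <=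
    C * expR (- (m%:R * alpha)) *
      (nu x (P i x u) * nu (F m x) (A m x (P j x v))).

Lemma cdominated_mul : cdominated ->
  exists C alpha : R, [/\ 1 < C, 0 < alpha & mul_dominated C alpha].
Proof.
move=> [C [alpha [C1 alpha0 H]]]; exists C, alpha; split=> // i j x u v m ij Lx.
have := H i j x u v 0 m ij Lx; rewrite add0r F0 !A0/=.
set den := nu x (P i x u) * _; have [den0 _|den0] := eqVneq den 0.
  (* If the denominator vanishes, one of the two projected vectors is 0, and so is the left-hand
     side. *)
  rewrite den0 mulr0; move/eqP: den0; rewrite mulf_eq0 => /orP[]/eqP/nu_eq0 e.
    by rewrite e linear0 nu0 mul0r.
  suff -> : P j x v = 0 by rewrite nu0 mulr0.
  by rewrite -(AK m x (P j x v)) e linear0.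
by move=> /(_ isT); rewrite ler_pdivrMr// lt_def den0 mulr_ge0.
Qed.

(** * Angles between the bundles, bounded projections and the spectral gap *)

Lemma expR_decay (D alpha : R) : 0 < alpha -> exists m : nat,
  D * expR (- (m%:R * alpha)) <= 2^-1.
Proof.
move=> alpha0; exists (Num.truncn (2 * D / alpha)).+1; set m := _.+1.
have : 2 * D / alpha < m%:R by exact: truncnS_gt.
rewrite ltr_pdivrMr// expRN ler_pdivrMr ?expR_gt0// => Dm.
have := expR_ge1Dx (m%:R * alpha); lra.
Qed.

Lemma nu_sum x (I : finType) (Q : pred I) (G : I -> V) :
  nu x (\sum_(i | Q i) G i) <= \sum_(i | Q i) nu x (G i).
Proof.
elim/big_ind2 : _ => [|a b c e ab ce|//]; first by rewrite nu0.
by rewrite (le_trans (nuD _ _ _))// lerD.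
Qed.

(* If the component w were much longer than z = w + v, then w and -v would be
   nearly equal, and so would their images under A m, whereas domination makes
   the image of v outgrow that of w. *)
Lemma angle_bound (m : nat) x w v : L x ->
  nu (F m x) (A m x w) * nu x v <= 2^-1 * (nu x w * nu (F m x) (A m x v)) ->
  nu x w <= 4 * kappa ^+ (2 * m) * nu x (w + v) /\
  nu x v <= 4 * kappa ^+ (2 * m) * nu x (w + v).
Proof.
move=> Lx dom; set z := w + v.
set K := kappa ^+ m; have K1 : 1 <= K by rewrite exprn_ege1.
rewrite mulnC exprM -/K.
have vK : nu x v <= K * nu (F m x) (A m x v) by exact: nu_le_pow.
have Kv : nu (F m x) (A m x v) <= K * nu x v by exact: nu_pow.
have zK : nu (F m x) (A m x z) <= K * nu x z by exact: nu_pow.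
have wz : nu x w <= nu x z + nu x v.
  by rewrite -(nuN x v) (le_trans _ (nuD _ _ _))// /z addrK.
have Avz : nu (F m x) (A m x v) <= nu (F m x) (A m x z) + nu (F m x) (A m x w).
  rewrite -(nuN _ (A m x w)) (le_trans _ (nuD _ _ _))// /z linearD.
  by rewrite [A m x w + _]addrC addrK.
have z0 := nu_ge0 x z; have v0 := nu_ge0 x v; have w0 := nu_ge0 x w.
suff vz : nu x v <= 3 * K ^+ 2 * nu x z.
  have : nu x z <= K ^+ 2 * nu x z by rewrite ler_peMl// exprn_ege1.
  have := mulr_ge0 (exprn_ge0 2 (le_trans ler01 K1)) z0.
  by split; lra.
have [v_eq0|v_neq0] := eqVneq v 0.
  by rewrite v_eq0 nu0 !mulr_ge0 ?exprn_ge0// (le_trans _ K1).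
have v_gt0 : 0 < nu x v by rewrite nu_gt0.
have Av0 := nu_ge0 (F m x) (A m x v).
suff : nu (F m x) (A m x v) <= 3 * K * nu x z.
  move=> h; rewrite (le_trans vK)//; apply: le_trans (ler_wpM2l _ h) _.
    exact: le_trans K1.
  by rewrite expr2; lra.
(* With X = |A v| |v|, [h1] and [h2] give X <= K|z||v| + (K|z||v| + X) / 2, whence the constant
   3. *)
rewrite -(ler_pM2r v_gt0).
have h1 : nu (F m x) (A m x v) * nu x v <=
    K * nu x z * nu x v + 2^-1 * (nu x w * nu (F m x) (A m x v)).
  apply: le_trans (ler_wpM2r v0 Avz) _; rewrite mulrDl lerD//.
  by rewrite ler_wpM2r.
have h2 : nu x w * nu (F m x) (A m x v) <=
    nu x z * (K * nu x v) + nu x v * nu (F m x) (A m x v).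
  by rewrite (le_trans (ler_wpM2r Av0 wz))// mulrDl lerD2r ler_wpM2l.
lra.
Qed.

(** The bundles are added one at a time: [angle_bound] compares the sum [w] of the first [l]
    components with the next one, and the induction hypothesis bounds the earlier components by
    [w]. *)
Lemma proj_bounded C alpha : 1 < C -> 0 < alpha -> mul_dominated C alpha ->
  exists2 p, 1 <= p & forall i x u, L x -> nu x (P i x u) <= p * nu x u.
Proof.
move=> C1 alpha0 dom.
suff H l : (l <= k)%N -> exists2 p, 1 <= p & forall (i : 'I_k) x u,
    L x -> (i < l)%N ->
    nu x (P i x u) <= p * nu x (\sum_(j < k | (j < l)%N) P j x u).
  have [p p1 pP] := H k (leqnn k).
  exists p => // i x u Lx; rewrite (le_trans (pP i x u Lx (ltn_ord i)))//.
  rewrite -[in leRHS](P_sum u Lx) le_eqVlt; apply/orP; left; apply/eqP.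
  by congr (_ * nu _ _); apply: eq_bigl => j; rewrite ltn_ord.
elim: l => [|l IH] lk; first by exists 1.
have [p p1 pP] := IH (ltnW lk); pose b := Ordinal lk.
have p0 : 0 <= p by exact: le_trans p1.
have C0 : 0 <= C by rewrite ltW// (lt_trans _ C1).
(* [m] must yield the factor 1/2 of [angle_bound] after summing at most [k] components, each of norm
   at most [p] times that of [w]. *)
have [m mP] := expR_decay (k%:R * (C * p)) alpha0.
have K1 : 1 <= kappa ^+ (2 * m) by rewrite exprn_ege1.
exists (4 * kappa ^+ (2 * m) * p) => [|i x u Lx il].
  have : 1 <= kappa ^+ (2 * m) * p by rewrite mulr_ege1.
  lra.
pose w := \sum_(j < k | (j < l)%N) P j x u.
have -> : \sum_(j < k | (j < l.+1)%N) P j x u = w + P b x u.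
  rewrite (bigD1 b)//= addrC; congr (_ + _); apply: eq_bigl => j.
  rewrite ltnS (leq_eqVlt j l) -val_eqE/=.
  by have [->|] := eqVneq (j : nat) l; rewrite ?ltnn ?andbT.
have [|wz vz] := @angle_bound m x w (P b x u) Lx.
  rewrite /w linear_sum/=.
  apply: le_trans (ler_wpM2r (nu_ge0 _ _) (nu_sum _ _ _)) _; rewrite mulr_suml.
  apply: le_trans (_ : k%:R * (C * p) * expR (- (m%:R * alpha)) *
      (nu x w * nu (F m x) (A m x (P b x u))) <= _); last first.
    by rewrite ler_wpM2r// mulr_ge0.
  apply: le_trans (_ : \sum_(j < k) (C * p * expR (- (m%:R * alpha)) *
      (nu x w * nu (F m x) (A m x (P b x u)))) <= _); last first.
    by rewrite sumr_const card_ord -[leLHS]mulr_natl !mulrA.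
  rewrite [leRHS](bigID (fun j : 'I_k => (j < l)%N))/= -[leLHS]addr0.
  have t0 : 0 <= C * p * expR (- (m%:R * alpha)) *
      (nu x w * nu (F m x) (A m x (P b x u))).
    by rewrite !mulr_ge0// expR_ge0.
  rewrite lerD ?sumr_ge0//; apply: ler_sum => j jl.
  apply: le_trans (dom j b x u u m jl Lx) _.
  apply: le_trans (_ : C * expR (- (m%:R * alpha)) *
      (p * nu x w * nu (F m x) (A m x (P b x u))) <= _).
    by rewrite ler_wpM2l ?mulr_ge0 ?expR_ge0// ler_wpM2r// pP.
  by rewrite le_eqVlt; apply/orP; left; apply/eqP; ring.
have z0 := nu_ge0 x (w + P b x u).
move: il; rewrite ltnS leq_eqVlt => /orP[/eqP il|il].
  have -> : i = b by exact/val_inj.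
  rewrite (le_trans vz)// ler_wpM2r// ler_peMr//; lra.
rewrite (le_trans (pP i x u Lx il))// (le_trans (ler_wpM2l p0 wz))//.
by rewrite le_eqVlt; apply/orP; left; apply/eqP; ring.
Qed.

(** The two operator norms are tested separately, on [u] and on [w]; domination is then applied to
    [u] and the preimage of [w] under [A N x]. *)
Lemma growth_gap C alpha p (i j : 'I_k) x (N : nat) : 1 < C -> 1 <= p ->
  (forall i x u, L x -> nu x (P i x u) <= p * nu x u) ->
  mul_dominated C alpha -> (i < j)%N -> L x ->
  fgrowth i x N * bgrowth j x N <= C * p ^+ 2 * expR (- (N%:R * alpha)).
Proof.
move=> C1 p1 pP dom ij Lx.
set D := C * p ^+ 2 * expR _.
have C0 : 0 <= C by rewrite ltW// (lt_trans _ C1).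
have p0 : 0 <= p by exact: le_trans p1.
have D0 : 0 <= D by rewrite !mulr_ge0 ?expR_ge0 ?exprn_ge0.
have b0 := bgrowth_gt0 j N Lx.
rewrite -ler_pdivlMr//; apply: opn_le => [|u]; first by rewrite divr_ge0// ltW.
rewrite comp_lfunE mulrAC ler_pdivlMr//.
(* [t] is the norm of the image of [u]; once nonzero it is divided out to isolate [bgrowth]. *)
set t := nu _ _; have [t0|t0] := eqVneq t 0; first by rewrite t0 mul0r mulr_ge0.
have {}t0 : 0 < t by rewrite lt_def t0 nu_ge0.
rewrite mulrC -ler_pdivlMr//; apply: opn_le => [|w].
  by rewrite divr_ge0 ?mulr_ge0// ltW.
rewrite comp_lfunE mulrAC ler_pdivlMr// mulrC.
have := dom i j x u (A (- N%:Z) (F N x) w) N ij Lx.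
rewrite -/t (PA j N) // AVK => /le_trans; apply.
apply: le_trans (_ : C * expR (- (N%:R * alpha)) *
    (p * nu x u * (p * nu (F N x) w)) <= _).
  rewrite ler_wpM2l ?mulr_ge0 ?expR_ge0// ler_pM// pP//; exact: FL.
by rewrite /D expr2; lra.
Qed.

Lemma cdominated_upper_lower : cdominated ->
  exists (alpha : R) (N0 : nat), [/\ 0 < alpha, (0 < N0)%N &
    forall (N : nat) (i j : 'I_k), (N0 <= N)%N -> j = i.+1 :> nat ->
      [/\ cupper i (fun x => N%:R^-1 * ln (fgrowth i x N)),
          clower j (fun x => - (N%:R^-1 * ln (bgrowth j x N)))
        & forall x, L x ->
            N%:R^-1 * ln (fgrowth i x N) - - (N%:R^-1 * ln (bgrowth j x N))
              <= - (alpha / 2)]].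
Proof.
move=> /cdominated_mul[C [alpha [C1 alpha0 dom]]].
have [p p1 pP] := proj_bounded C1 alpha0 dom.
have Cp : 0 < C * p ^+ 2.
  by rewrite mulr_gt0 ?exprn_gt0 ?(lt_trans _ C1)// (lt_le_trans _ p1).
(* For such [N] the constant satisfies ln (C p^2) < N alpha / 2: it uses up half of the rate [alpha]
   and leaves alpha / 2 for the gap. *)
exists alpha, (Num.truncn (ln (C * p ^+ 2) / (alpha / 2))).+1; split=> //.
move=> N i j N0N ij; have N0 : (0 < N)%N by exact: leq_trans N0N.
split; [exact: fgrowth_upper pP _ _ N0|exact: bgrowth_lower pP _ _ N0|].
move=> x Lx; rewrite opprK -mulrDr.
have NR : 0 < N%:R :> R by rewrite ltr0n.
have a0 := fgrowth_gt0 i N Lx; have b0 := bgrowth_gt0 j N Lx.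
rewrite mulrC ler_pdivrMr// -lnM ?posrE//.
have ij' : (i < j)%N by rewrite ij.
have gap := growth_gap N C1 p1 pP dom ij' Lx.
apply: le_trans (_ : ln (C * p ^+ 2 * expR (- (N%:R * alpha))) <= _).
  have e0 : 0 < C * p ^+ 2 * expR (- (N%:R * alpha)) by rewrite mulr_gt0 ?expR_gt0.
  by rewrite ler_ln ?posrE// mulr_gt0.
rewrite lnM ?posrE ?expR_gt0// expRK.
have : ln (C * p ^+ 2) / (alpha / 2) < N%:R.
  by rewrite (lt_le_trans (truncnS_gt _))// ler_nat.
rewrite ltr_pdivrMr ?divr_gt0//; lra.
Qed.

(** * From upper and lower functions back to domination *)

Definition ratio_bound (C alpha : R) (i j : 'I_k) : Prop :=
  forall x u v (n : int) (m : nat), L x ->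
    nu (F (n + m%:Z) x) (A (n + m%:Z) x (P i x u)) * nu (F n x) (A n x (P j x v))
    <= C * expR (- (m%:R * alpha)) *
      (nu (F n x) (A n x (P i x u)) *
       nu (F (n + m%:Z) x) (A (n + m%:Z) x (P j x v))).

(** The two operator bounds are evaluated on orbit vectors, which the projections fix, and
    multiplied; the exponents differ by at most - m alpha. *)
Lemma upper_lower_ratio i j h h' alpha : cupper i h -> clower j h' ->
  (forall x, L x -> h x - h' x <= - alpha) ->
  exists2 C, 1 <= C & ratio_bound C alpha i j.
Proof.
move=> [K [K1 HK]] [K' [K'1 HK']] gap.
have K0 : 0 <= K by rewrite ltW// (lt_trans _ K1).
have K'0 : 0 <= K' by rewrite ltW// (lt_trans _ K'1).
have KK1 : 1 <= K * K' by rewrite mulr_ege1// ltW.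
exists (K * K') => // x u v n [|m] Lx.
  (* Upper and lower functions say nothing for m = 0; there K K' >= 1 suffices. *)
  rewrite addr0 mul0r oppr0 expR0 mulr1 ler_peMl//; exact: mulr_ge0.
set S := \sum_(l < m.+1) h (F (n + l%:Z) x).
set S' := \sum_(l < m.+1) h' (F (n + l%:Z) x).
have up : nu (F (n + m.+1%:Z) x) (A (n + m.+1%:Z) x (P i x u)) <=
    K * expR S * nu (F n x) (A n x (P i x u)).
  apply: le_trans (ler_wpM2r (nu_ge0 _ _) (HK x n m.+1 Lx isT)).
  apply: le_trans (le_opn _ _ _ _).
  by rewrite !comp_lfunE AK P_id.
have lo : nu (F n x) (A n x (P j x v)) <=
    K' * expR (- S') * nu (F (n + m.+1%:Z) x) (A (n + m.+1%:Z) x (P j x v)).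
  apply: le_trans (ler_wpM2r (nu_ge0 _ _) (HK' x n m.+1 Lx isT)).
  apply: le_trans (le_opn _ _ _ _).
  by rewrite !comp_lfunE AK P_id.
have SS' : S - S' <= - (m.+1%:R * alpha).
  rewrite /S /S' -sumrB.
  apply: le_trans (_ : \sum_(l < m.+1) - alpha <= _).
    by apply: ler_sum => l _; apply: gap; exact: FL.
  by rewrite sumr_const card_ord mulNrn mulr_natl.
apply: le_trans (ler_pM _ _ up lo) _ => //.
rewrite mulrACA ler_wpM2r ?mulr_ge0// mulrACA ler_wpM2l ?mulr_ge0//.
by rewrite -expRD ler_expR.
Qed.

(** The bounds are multiplied along a nonzero vector of the middle bundle, whose norms cancel. *)
Lemma ratio_bound_trans C C' alpha i j l : 0 <= alpha -> 0 <= C -> 0 <= C' ->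
  ratio_bound C alpha i j -> ratio_bound C' alpha j l ->
  ratio_bound (C * C') alpha i l.
Proof.
move=> alpha0 C0 C'0 Tij Tjl x u v n m Lx.
have [w Pw] := P_neq0 j Lx.
have a0 : 0 < nu (F n x) (A n x (P j x w)) by rewrite nu_gt0 A_neq0.
have b0 : 0 < nu (F (n + m%:Z) x) (A (n + m%:Z) x (P j x w)).
  by rewrite nu_gt0 A_neq0.
have := ler_pM (mulr_ge0 (nu_ge0 _ _) (nu_ge0 _ _))
  (mulr_ge0 (nu_ge0 _ _) (nu_ge0 _ _)) (Tij x u w n m Lx) (Tjl x w v n m Lx).
set e := expR _; set a := nu _ (A _ _ (P j x w)) in a0 *.
set b := nu _ (A _ _ (P j x w)) in b0 *.
set u' := nu _ (A (n + _) _ (P i x u)); set u0 := nu _ (A _ _ (P i x u)).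
set v' := nu _ (A (n + _) _ (P l x v)); set v0 := nu _ (A _ _ (P l x v)) => H.
have e0 : 0 <= e by exact: expR_ge0.
have e1 : e <= 1 by rewrite -expR0 ler_expR oppr_le0 mulr_ge0.
have H' : u' * v0 <= C * C' * (e * e) * (u0 * v').
  rewrite -(ler_pM2r (mulr_gt0 a0 b0)).
  rewrite [leLHS](_ : _ = u' * a * (b * v0)); last by ring.
  by rewrite (le_trans H)// le_eqVlt; apply/orP; left; apply/eqP; ring.
(* One of the two factors [e] is at most 1 and is dropped, so the rate stays [alpha]. *)
rewrite (le_trans H')// ler_wpM2r ?mulr_ge0 ?nu_ge0// ler_wpM2l ?mulr_ge0//.
by rewrite ler_piMl.
Qed.

Lemma upper_lower_cdominated alpha : 0 < alpha ->
  (forall i j : 'I_k, j = i.+1 :> nat -> exists h h',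
    [/\ cupper i h, clower j h' & forall x, L x -> h x - h' x <= - alpha]) ->
  cdominated.
Proof.
move=> alpha0 adj.
have T (ij : 'I_k * 'I_k) : exists C, 1 <= C /\
    ((ij.1 < ij.2)%N -> ratio_bound C alpha ij.1 ij.2).
  case: ij => i [j jk] /=.
  (* For fixed [i], the chain is lengthened by one adjacent pair at each step. *)
  elim: j jk => [|j IH] jk; first by exists 1.
  have jk' := ltnW jk; have [C [C1 CT]] := IH jk'.
  have [h [h' [hup hlo hh']]] := adj (Ordinal jk') (Ordinal jk) erefl.
  have [C' C'1 C'T] := upper_lower_ratio hup hlo hh'.
  have [ij|ij] := ltnP i j.
    exists (C * C'); split=> [|_]; first by rewrite mulr_ege1.
    have := @ratio_bound_trans C C' alpha i (Ordinal jk') (Ordinal jk).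
    by apply; rewrite ?(ltW alpha0) ?(le_trans ler01)//; exact: CT.
  exists C'; split=> // ij'.
  suff -> : i = Ordinal jk' by [].
  by apply/val_inj/eqP; rewrite /= eqn_leq ij -ltnS ij'.
have /choice[Cf CfP] := T.
(* The sum over the finitely many pairs gives one constant for all of them. *)
exists (1 + \sum_ij Cf ij + 1), alpha; split=> //.
  rewrite ltr_pwDr// lerDl sumr_ge0// => ij _.
  by rewrite (le_trans ler01)//; case: (CfP ij).
move=> i j x u v n m ij Lx den den0.
rewrite ler_pdivrMr; last by rewrite lt_def den0 mulr_ge0.
have [_ /(_ ij) H] := CfP (i, j); apply: le_trans (H x u v n m Lx) _.
rewrite ler_wpM2r ?mulr_ge0// ler_wpM2r ?expR_ge0//.
rewrite (bigD1 (i, j))//=.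
have : 0 <= \sum_(p | p != (i, j)) Cf p.
  by apply: sumr_ge0 => p _; rewrite (le_trans ler01)//; case: (CfP p).
lra.
Qed.

End Cocycle.

(** * The derivative cocycle *)

Section Diffeo.
Variables (R : realType) (d : nat) (M : closedManifold R d) (f : diffeo M).

Lemma iterzS n x : iterz f (n + 1) x = f (iterz f n x).
Proof.
case: n => [n|[|n]]; first by rewrite -PoszD addn1.
  by rewrite /= diffeo_invK.
have -> : Negz n.+1 + 1 = Negz n.
  by rewrite !NegzE -[n.+2]addn1 PoszD opprD addrNK.
by rewrite /= diffeo_invK.
Qed.

Lemma iterzD n m x : iterz f (n + m) x = iterz f m (iterz f n x).
Proof.
have iterzP l y : iterz f (l - 1) y = diffeo_inv f (iterz f l y).
  by rewrite -{2}[l](subrK 1) iterzS diffeoK.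
elim/int_rec: m => [|m IH|m IH]; first by rewrite addr0.
  by rewrite -[m.+1]addn1 PoszD addrA !iterzS IH.
by rewrite -[m.+1]addn1 PoszD opprD addrA !iterzP IH.
Qed.

Lemma mdiff_iterz n : mdiff (iterz f n).
Proof.
have mdiff_iter (h : M -> M) m : mdiff h -> mdiff (iter m h).
  move=> dh; elim: m => [|m IH]; first exact: mdiff_id.
  exact: mdiff_comp IH dh.
case: n => n; apply: mdiff_iter; apply: C1_map_mdiff.
  exact: diffeo_C1.
exact: diffeo_inv_C1.
Qed.

Lemma Diter0 x u : Diter f 0 x u = u.
Proof.
apply: etrans (tangent_mapE id x u) _.
exact: chart_diff_id (chart_at_dom x).
Qed.

Lemma DiterD n m x u :
  Diter f (n + m) x u = Diter f m (iterz f n x) (Diter f n x u).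
Proof.
have e : iterz f (n + m) = iterz f m \o iterz f n.
  by apply/funext => y; exact: iterzD.
rewrite {1}/Diter e.
by apply: tangent_map_comp; exact: mdiff_iterz.
Qed.

Variable L : set M.
Hypothesis L_invariant : f @` L = L.

Lemma iterz_invariant n x : L x -> L (iterz f n x).
Proof.
have fL y : L y -> L (f y) by move=> Ly; rewrite -L_invariant; exists y.
have fVL y : L y -> L (diffeo_inv f y).
  move=> Ly; have : (f @` L) y by rewrite L_invariant.
  by case=> z Lz <-; rewrite diffeoK.
by move=> Lx; case: n => n; elim: n => [|n IH] //=; do ?[exact: fL|exact: fVL].
Qed.

(** * Oblique projections and their equivariance *)

Section Splitting.
Variables (k : nat) (dims : 'I_k -> nat) (E : 'I_k -> M -> {vspace 'rV[R]_d}).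
Hypothesis dims_ge1 : forall i, (1 <= dims i)%N.
Hypothesis E_splitting : invariant_splitting f L E dims.

Lemma oblique_proj_sum (w : 'I_k -> 'rV[R]_d) i x : L x ->
  (forall j, w j \in E j x) -> oblique_proj E i x (\sum_j w j) = w i.
Proof.
move=> Lx wE; have [dE _ _ _] := E_splitting Lx.
set W := (\sum_(j < k | j != i) E j x)%VS.
have EW : (E i x :&: W = 0)%VS.
  by have /directv_sumP/(_ i isT) := dE.
have rest : \sum_(j | j != i) w j \in W by apply: memv_sumr => j _; exact: wE.
rewrite (bigD1 i)//= linearD/= {1}/oblique_proj daddv_pi_id//.
have WE : (W :&: E i x = 0)%VS by rewrite capvC.
(* The two complementary projections add up to the identity; the one onto [W] fixes the remaining
   sum, so the one onto [E i x] kills it. *)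
have := daddv_pi_add EW (subvP (addvSr (E i x) W) _ rest).
rewrite (daddv_pi_id WE rest) => /(canRL (addrK _)).
by rewrite subrr /oblique_proj -/W => ->; rewrite addr0.
Qed.

Lemma oblique_proj_mem i x u : oblique_proj E i x u \in E i x.
Proof. exact: memv_pi. Qed.

Lemma sum_oblique_proj x u : L x -> \sum_i oblique_proj E i x u = u.
Proof.
move=> Lx; have [_ fE _ _] := E_splitting Lx.
have : u \in (\sum_i E i x)%VS by rewrite fE memvf.
move=> /memv_sumP[w wE ->].
by apply: eq_bigr => i _; apply: oblique_proj_sum => // j; exact: wE.
Qed.

Lemma oblique_proj_id i x u : L x -> u \in E i x -> oblique_proj E i x u = u.
Proof.
move=> Lx uE; have := @oblique_proj_sum (fun j => if j == i then u else 0) i x Lx.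
rewrite (bigD1 i)//= eqxx big1 ?addr0 => [|j /negPf->//].
by apply => j; case: eqP => [->//|_]; exact: mem0v.
Qed.

Lemma oblique_proj_neq0 i x : L x -> exists u, oblique_proj E i x u != 0.
Proof.
move=> Lx; have [_ _ dE _] := E_splitting Lx.
exists (vpick (E i x)); rewrite oblique_proj_id ?memv_pick// vpick0.
by rewrite -dimv_eq0 dE -lt0n.
Qed.

Lemma Diter_mem i n x u : L x -> u \in E i x -> Diter f n x u \in E i (iterz f n x).
Proof.
have fwd y v : L y -> v \in E i y -> Diter f 1 y v \in E i (iterz f 1 y).
  move=> Ly vE; have [_ _ _ /(_ i) invE] := E_splitting Ly.
  by rewrite (_ : iterz f 1 y = f y)// -invE memv_img.
have bwd y v : L y -> v \in E i y -> Diter f (-1) y v \in E i (iterz f (-1) y).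
  move=> Ly; have Lz := iterz_invariant (-1) Ly; set z := iterz f (-1) y in Lz *.
  have ez : y = iterz f 1 z by rewrite /z -iterzD.
  have [_ _ _ /(_ i) invE] := E_splitting Lz.
  (* Invariance is an equality of subspaces, so a vector over f(z) is the image of one over z, which
     the inverse derivative recovers. *)
  rewrite {1}ez (_ : iterz f 1 z = f z)// -invE => /memv_imgP[w wE ->].
  by rewrite ez -DiterD subrr Diter0.
move=> Lx uE; elim/int_rec: n => [|n IH|n IH]; first by rewrite Diter0.
  rewrite -[n.+1]addn1 PoszD DiterD iterzD; apply: fwd => //; exact: iterz_invariant.
rewrite -[n.+1]addn1 PoszD opprD DiterD iterzD; apply: bwd => //.
exact: iterz_invariant.
Qed.

(** The derivative maps the decomposition of [u] to a decomposition along the splitting at the image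
    point, and components are unique. *)
Lemma Diter_oblique_proj i n x u : L x ->
  Diter f n x (oblique_proj E i x u) =
  oblique_proj E i (iterz f n x) (Diter f n x u).
Proof.
move=> Lx; rewrite -[in RHS](sum_oblique_proj u Lx) linear_sum/=.
rewrite (@oblique_proj_sum (fun j => Diter f n x (oblique_proj E j x u)))//.
  exact: iterz_invariant.
by move=> j; apply: Diter_mem => //; exact: oblique_proj_mem.
Qed.

End Splitting.

Lemma Diter1_bounded (g : continuous_metric M) : compact L ->
  exists2 kappa : R, 1 <= kappa & forall x u, L x ->
    tnorm g (iterz f 1 x) (Diter f 1 x u) <= kappa * tnorm g x u /\
    tnorm g (iterz f (-1) x) (Diter f (-1) x u) <= kappa * tnorm g x u.
Proof.
move=> cL.
have [C C0 CP] := tangent_map_bounded g cL (diffeo_C1 f).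
have [C' C'0 C'P] := tangent_map_bounded g cL (diffeo_inv_C1 f).
exists (1 + C + C') => [|x u Lx]; first by rewrite -addrA lerDl addr_ge0.
split.
  apply: le_trans (CP x Lx u) _; rewrite ler_wpM2r ?tnorm_ge0//; lra.
apply: le_trans (C'P x Lx u) _; rewrite ler_wpM2r ?tnorm_ge0//; lra.
Qed.

End Diffeo.

Theorem theorem3p3 (R : realType) (d : nat) (M : closedManifold R d)
    (g : continuous_metric M) (f : diffeo M) (L : set M)
    (L_compact : compact L) (L_invariant : f @` L = L)
    (k : nat) (k_ge2 : (2 <= k)%N)
    (dims : 'I_k -> nat) (dims_ge1 : forall i, (1 <= dims i)%N)
    (E : 'I_k -> M -> {vspace 'rV[R]_d})
    (E_splitting : invariant_splitting f L E dims) :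
  dominated g f L E <->
  exists (alpha : R) (N0 : nat), [/\ 0 < alpha, (0 < N0)%N &
    forall (N : nat) (i j : 'I_k), (N0 <= N)%N -> j = i.+1 :> nat ->
      [/\ upper_function g f L E i (rho_plus g f E N i),
          lower_function g f L E j (rho_minus g f E N j)
        & forall x, L x ->
            rho_plus g f E N i x - rho_minus g f E N j x <= - (alpha / 2)]].
Proof.
have [kappa kappa1 kappaP] := Diter1_bounded f g L_compact.
have FL n x : L x -> L (iterz f n x) by exact: iterz_invariant.
have Pid i x u : L x ->
    oblique_proj E i x (oblique_proj E i x u) = oblique_proj E i x u.
  by move=> Lx; apply: (oblique_proj_id E_splitting) => //; exact: oblique_proj_mem.
have Pneq0 i x : L x -> exists u, oblique_proj E i x u != 0.
  exact: (oblique_proj_neq0 dims_ge1 E_splitting).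
have Psum x u : L x -> \sum_i oblique_proj E i x u = u.
  exact: (sum_oblique_proj E_splitting).
have PA i n x u : L x -> Diter f n x (oblique_proj E i x u) =
    oblique_proj E i (iterz f n x) (Diter f n x u).
  exact: (Diter_oblique_proj L_invariant E_splitting).
split.
  exact: (cdominated_upper_lower FL (fun=> erefl) (iterzD f) (Diter0 f)
    (DiterD f) Pid Psum Pneq0 PA (tnorm_ge0 g) (tnorm_gt0 g) (tnormN g)
    (tnormD g) (opnorm_ge0 g) (le_opnorm g) (@opnorm_le _ _ _ g) kappa1
    (fun x u Lx => (kappaP x u Lx).1) (fun x u Lx => (kappaP x u Lx).2)).
move=> [alpha [N0 [alpha0 N00 H]]].
apply: (upper_lower_cdominated FL (Diter0 f) (DiterD f) Pid Pneq0
  (tnorm_ge0 g) (tnorm_gt0 g) (le_opnorm g) (alpha := alpha / 2)).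
  by rewrite divr_gt0.
(* The single time N = [N0] suffices for the converse, with rate alpha / 2. *)
move=> i j ij; exists (rho_plus g f E N0 i), (rho_minus g f E N0 j).
exact: H.
Qed.
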